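(* Let $m$ be a positive integer and let $\alpha_1,\dots,\alpha_k$ be positive real numbers, not all rational. Then $\{S(\alpha_1,0),\dots,S(\alpha_k,0)\}$ is an irreducible $m$-EEC if and only if $k=2$ and $\sum_{i=1}^{k}\frac{1}{\alpha_i} = m$.
   Context: $\mathbb{N}$ denotes the set of positive integers. For real $\alpha>0$ and real $\beta$, the Beatty sequence $S(\alpha,\beta)$ is the multiset $\{\lfloor n\alpha+\beta\rfloor : n\in\mathbb{N}\}$ (an integer is counted as many times as it occurs). A finite family $\{S_i : i\in I\}$ of multisets of integers is an $m$-EEC (eventual exact $m$-cover) if every sufficiently large positive integer occurs exactly $m$ times in the multiset union of the family, counting multiplicities. An $m$-EEC with $m>1$ is reducible if there are positive integers $m_1,m_2$ with $m_1+m_2=m$ and a partition $I=J\sqcup K$ such that $\{S_i:i\in J\}$ is an $m_1$-EEC and $\{S_i : i\in K\}$ is an $m_2$-EEC; otherwise it is irreducible. (Every $1$-EEC counts as irreducible.) *)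

(* Defs.v *)
From HB Require Import structures.
From mathcomp Require Import all_boot all_order all_algebra finmap.
From mathcomp Require Import boolp classical_sets cardinality reals.

Set Implicit Arguments.
Unset Strict Implicit.
Unset Printing Implicit Defensive.

Import Order.TTheory GRing.Theory Num.Theory.

Local Open Scope ring_scope.

(* A multiset of integers, given by its multiplicity function. *)
Definition zmultiset := int -> nat.

Definition beatty_fiber (R : realType) (alpha beta : R) (z : int) : set nat :=
  [set n | (0 < n)%N /\ Num.floor (n%:R * alpha + beta) = z]%classic.

(* [fset_set] is a junk value on infinite sets; for [0 < alpha] the fibers are
   finite. *)
Lemma finite_beatty_fiber (R : realType) (alpha beta : R) (z : int) :
  0 < alpha -> finite_set (beatty_fiber alpha beta z).
Proof.
move=> a0; pose N := (Num.truncn ((z%:~R + 1 - beta) / alpha)).+1.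
apply: (sub_finite_set _ (finite_II N)) => n [_ nz] /=.
have lt_n : n%:R < (z%:~R + 1 - beta) / alpha.
  by rewrite ltr_pdivlMr// ltrBrDr -nz -[1]/(1%:~R) -intrD floorD1_gt.
by rewrite -(ltr_nat R); apply: lt_trans lt_n _; apply: truncnS_gt.
Qed.

Definition beatty (R : realType) (alpha beta : R) : zmultiset :=
  fun z => #|` fset_set (beatty_fiber alpha beta z) |.

(* The subfamily of [S] indexed by [J] is an [m]-EEC. *)
Definition is_eec (I : finType) (S : I -> zmultiset) (J : {set I}) (m : nat) :
    Prop :=
  exists z0 : int, forall z : int,
    0 < z -> z0 <= z -> (\sum_(i in J) S i z)%N = m.

Definition reducible_eec (I : finType) (S : I -> zmultiset) (m : nat) : Prop :=
  (1 < m)%N /\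
  exists (m1 m2 : nat) (J K : {set I}),
    [/\ (0 < m1)%N, (0 < m2)%N & (m1 + m2)%N = m] /\
    [/\ J :|: K = [set: I], [disjoint J & K],
        is_eec S J m1 & is_eec S K m2].

Definition irreducible_eec (I : finType) (S : I -> zmultiset) (m : nat) :
    Prop :=
  is_eec S [set: I] m /\ ~ reducible_eec S m.

(* Main.v *)
Require Import Defs.
From mathcomp Require Import all_boot all_order all_algebra finmap.
From mathcomp Require Import boolp classical_sets cardinality reals.
From mathcomp Require Import topology normedtype derive realfun trigo.
From mathcomp Require Import zify ring lra.

(** Put [theta_i := - 1 / alpha_i].  For [z >= 1] the multiplicity of [z] in
    [S(alpha_i, 0)] is [floor (z theta_i) - floor ((z + 1) theta_i)], so a
    subfamily is an [m]-EEC iff the sum of its [1 / alpha_i] is [m] and the sum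
    of its fractional parts [{z theta_i}] is eventually constant in [z].  If
    [theta_i + theta_j] is an integer and [theta_i] is irrational then
    [{z theta_i} + {z theta_j} = 1]: such a pair is an EEC, and it splits off
    any EEC containing it.

    It remains to find such a pair in an EEC with an irrational member.  Choose
    an irrational [theta_i] with [Z theta_i + Z] maximal, and average
    [sin (2 pi z theta_i)] times the (eventually constant) sum of the
    [{z theta_j}] over [z < N].  The term of [j] tends to zero unless [theta_i]
    is in [Z theta_j + Z], which by maximality means
    [theta_j = theta_i] or [theta_j = - theta_i] modulo 1.  Were the second
    case absent, all remaining terms would be the same, with a negative mean,
    whereas the total tends to zero. *)

Set Implicit Arguments.
Unset Strict Implicit.
Unset Printing Implicit Defensive.

Import Order.TTheory GRing.Theory Num.Theory.
Import numFieldTopology.Exports numFieldNormedType.Exports.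
Local Open Scope classical_set_scope.
Local Open Scope ring_scope.

(** * Estimates for the sine *)

Section Sine.
Variable R : realType.
Implicit Types x y : R.

Lemma sin_mean_value x : 0 < x -> exists2 c, 0 < c < x & sin x = cos c * x.
Proof.
move=> x0.
have sinC : {within `[0, x], continuous (@sin R)}.
  by apply: continuous_subspaceT => y; exact: continuous_sin.
have [c] := MVT x0 (fun y _ => is_derive_sin y) sinC.
rewrite in_itv /= sin0 !subr0 => c0 ->; by exists c.
Qed.

Lemma sin_le_id x : 0 <= x -> sin x <= x.
Proof.
rewrite le_eqVlt => /predU1P[<-|x0]; first by rewrite sin0.
have [c _ ->] := sin_mean_value x0.
by rewrite ler_piMl ?cos_le1// ltW.
Qed.

(** Halving the angle and applying the mean value theorem give [sin x = x * cos c * cos (x / 2)]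
    with [c < x / 2]. Both cosines are at least [cos (pi / 4)], whose square is 1/2. *)
Lemma sin_ge_half x : 0 <= x -> x <= pi / 2 -> x / 2 <= sin x.
Proof.
rewrite le_eqVlt => /predU1P[<-|x0 xpi]; first by rewrite sin0 mul0r.
have p0 := @pi_gt0 R.
have [c /andP[c0 cx] sc] := @sin_mean_value (x / 2) ltac:(lra).
have c2 : cos (pi / 4%:R : R) ^+ 2 = 2^-1.
  have := cos_mulr2n (pi / 4%:R : R).
  have -> : (pi / 4%:R : R) *+ 2 = pi / 2 by lra.
  rewrite cos_pihalf; lra.
have cp : 0 < cos (pi / 4%:R : R) by apply: cos_gt0_pihalf; lra.
have le1 : cos (pi / 4%:R : R) <= cos (x / 2).
  by rewrite leNgt ltr_cos ?in_itv //= -?leNgt; lra.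
have le2 : cos (pi / 4%:R : R) <= cos c.
  by rewrite leNgt ltr_cos ?in_itv //= -?leNgt; lra.
have -> : sin x = 2 * sin (x / 2) * cos (x / 2).
  rewrite [in LHS](_ : x = (x / 2) *+ 2); last by lra.
  rewrite sin_mulr2n; ring.
rewrite sc; set a := cos c in le2 *; set b := cos (x / 2) in le1 *.
set d := cos (pi / 4) in c2 cp le1 le2.
have : 2^-1 <= a * b by rewrite -c2 expr2 ler_pM // ltW.
by move=> ab; rewrite [leRHS](_ : _ = x * (a * b)) ?ler_pM2l //; field.
Qed.

Lemma sin2piDint x (n : int) : sin (2 * pi * (x + n%:~R)) = sin (2 * pi * x).
Proof.
have per (y : R) (k : nat) : sin (2 * pi * (y + k%:R)) = sin (2 * pi * y).
  have -> : 2 * pi * (y + k%:R) = 2 * pi * y + pi *+ 2 *+ k.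
    by rewrite -mulrnA -[in RHS](mulr_natr pi) natrM; ring.
  exact: periodicn (@sinD2pi R) k _.
case: n => k; first by rewrite -pmulrn per.
by rewrite NegzE mulrNz -pmulrn -[in RHS](subrK k.+1%:R x) per.
Qed.

(** A nearest integer serves as [q]: at distance [s <= 1/2] from it, [sin_ge_half] and [pi >= 2]
    give [sin (pi * s) >= pi * s / 2 >= s]. *)
Lemma dist_int_le_sinpi x : exists q : int, `|x - q%:~R| <= `|sin (pi * x)|.
Proof.
pose q := Num.floor (x + 1/2); exists q.
have [/andP[q1 q2]] : q%:~R <= x + 1/2 < (q + 1)%:~R by exact: floor_itv.
rewrite intrD in q2; pose t := x - q%:~R.
have -> : `|sin (pi * x)| = `|sin (pi * t)|.
  (* Squaring removes the sign depending on the parity of [q]: the squared sine is a function of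
     [cos (2 * pi * y)], which has period 1 in [y]. *)
  have : sin (pi * x) ^+ 2 = sin (pi * t) ^+ 2.
    have h y : sin (pi * y) ^+ 2 = (1 - cos (2 * pi * y)) / 2 :> R.
      have := cos_mulr2n (pi * y); have := cos2Dsin2 (pi * y).
      have -> : (pi * y) *+ 2 = 2 * pi * y by ring.
      lra.
    rewrite !h; congr ((1 - _) / 2).
    have h' y : cos (2 * pi * y) = sin (2 * pi * (y + 1/4)) :> R.
      by rewrite -sinDpihalf; congr sin; field; rewrite ?pnatr_eq0.
    by rewrite !h' -(sin2piDint (t + 1/4) q); congr sin; rewrite /t; ring.
  by move=> /eqP; rewrite eqf_sqr => /orP[]/eqP ->; rewrite ?normrN.
have key s : 0 <= s -> s <= 1/2 -> s <= `|sin (pi * s)| :> R.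
  move=> s0 s1; have p2 := @pi_ge2 R.
  have ps : pi * s <= pi * (1 / 2) by rewrite ler_pM2l //; lra.
  have ps0 : 2 * s <= pi * s by rewrite ler_wpM2r.
  apply: le_trans (ler_norm _).
  by have := @sin_ge_half (pi * s) ltac:(lra) ltac:(lra); lra.
have t1 : - (1/2) <= t <= 1/2 by rewrite /t; lra.
rewrite -/t; have [t0|t0] := leP 0 t; first by rewrite ger0_norm // key //; lra.
by rewrite ltr0_norm // -[leRHS]normrN -sinN -mulrN key //; lra.
Qed.

End Sine.

(** * Fractional parts and their correlation with a sine *)

Section FractionalPart.
Variable R : realType.
Implicit Types (x y theta xi : R) (e : nat -> R).

Definition frac x : R := x - (Num.floor x)%:~R.

Lemma frac_ge0 x : 0 <= frac x.
Proof. by rewrite subr_ge0 floor_le. Qed.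

Lemma frac_lt1 x : frac x < 1.
Proof. by rewrite ltrBlDr addrC -[X in _ + X]/(1%:~R) -intrD floorD1_gt. Qed.

Lemma norm_frac_le1 x : `|frac x| <= 1.
Proof. by rewrite ger0_norm ?frac_ge0 // ltW // frac_lt1. Qed.

Lemma frac_def x y (n : int) : x = n%:~R + y -> 0 <= y < 1 -> frac x = y.
Proof.
move=> -> /andP[y0 y1]; rewrite /frac (@floor_def _ _ n) ?[_ + y]addrC ?addrK //.
by rewrite intrD [y + _]addrC lerDl ltrD2l y0 y1.
Qed.

Lemma fracDint x (n : int) : frac (x + n%:~R) = frac x.
Proof.
apply: (@frac_def _ _ (Num.floor x + n)); last by rewrite frac_ge0 frac_lt1.
by rewrite intrD /frac; ring.
Qed.

Lemma fracD x y :
  frac (x + y) = frac x + frac y \/ frac (x + y) = frac x + frac y - 1.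
Proof.
have [x0 x1 y0 y1] := And4 (frac_ge0 x) (frac_lt1 x) (frac_ge0 y) (frac_lt1 y).
have [lt1|ge1] := ltP (frac x + frac y) 1; [left|right].
  apply: (@frac_def _ _ (Num.floor x + Num.floor y)); last lra.
  by rewrite intrD /frac; ring.
apply: (@frac_def _ _ (Num.floor x + Num.floor y + 1)); last lra.
by rewrite !intrD /frac; ring.
Qed.

Lemma fracN x : frac x != 0 -> frac (- x) = 1 - frac x.
Proof.
move=> x0; have := frac_ge0 x; have := frac_lt1 x; rewrite le_eqVlt eq_sym (negPf x0) /=.
move=> x1 x2; apply: (@frac_def _ _ (- Num.floor x - 1)); last lra.
by rewrite intrB mulrNz /frac; ring.
Qed.

(* The left-hand side is [d * (1 - d)] with [d] the distance to the nearest
   integer. *)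
Lemma frac_dist_int x (p : int) : frac x * (1 - frac x) <= `|x - p%:~R|.
Proof.
have [x0 x1] := (frac_ge0 x, frac_lt1 x).
have xE : x = frac x + (Num.floor x)%:~R by rewrite /frac; ring.
have [le|lt] := leP p (Num.floor x).
  have le' : p%:~R <= (Num.floor x)%:~R :> R by rewrite ler_int.
  by rewrite ger0_norm; nra.
have lt' : (Num.floor x)%:~R + 1 <= p%:~R :> R.
  by rewrite -[1]/(1%:~R) -intrD ler_int lezD1.
by rewrite ler0_norm; nra.
Qed.

(** With [t = frac x - 1/2] the sine is [- sin (2 * pi * t)]. The claim then follows from
    [0 <= sin u <= u] on [[0, pi]], and by parity for negative [t]. *)
Lemma sin2pi_frac x :
  sin (2 * pi * x) * (frac x - 1/2) <= - (sin (2 * pi * x) ^+ 2 / (2 * pi)).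
Proof.
have p0 := @pi_gt0 R; have [s0 s1] := (frac_ge0 x, frac_lt1 x).
set s := frac x in s0 s1 *; pose t := s - 1/2.
have -> : sin (2 * pi * x) = - sin (2 * pi * t).
  have -> : x = s + (Num.floor x)%:~R by rewrite /s /frac; ring.
  rewrite sin2piDint (_ : 2 * pi * s = 2 * pi * t + pi) ?sinDpi //.
  by rewrite /t; field.
rewrite -/t; have key (u : R) : 0 <= u -> u <= 1/2 ->
    sin (2 * pi * u) ^+ 2 / (2 * pi) <= sin (2 * pi * u) * u.
  move=> u0 u1; rewrite ler_pdivrMr; last by rewrite mulr_gt0.
  have u2 : 0 <= 2 * pi * u by rewrite mulr_ge0 // mulr_ge0 // ltW.
  have u3 : 2 * pi * u <= pi.
    by rewrite -[leRHS]mulr1 mulrAC mulrC ler_wpM2l ?(ltW p0) //; lra.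
  rewrite expr2 -[leRHS]mulrA; apply: ler_wpM2l; first by apply: sin_ge0_pi; lra.
  by apply: le_trans (sin_le_id u2) _; rewrite mulrC.
have ts : - (1/2) <= t <= 1/2 by rewrite /t; lra.
rewrite sqrrN mulNr lerN2; have [t0|t0] := leP 0 t; first by apply: key => //; lra.
have := key (- t) ltac:(lra) ltac:(lra).
by rewrite !mulrN sinN sqrrN mulNr opprK.
Qed.

Lemma sum_shift e h N : \sum_(z < N) (e (z + h)%N - e z) =
  \sum_(z < h) e (N + z)%N - \sum_(z < h) e z.
Proof.
elim: N => [|N IH]; first by rewrite big_ord0 subrr.
rewrite big_ord_recr /= IH.
have : \sum_(z < h) e (N + z)%N + e (N + h)%N = e N + \sum_(z < h) e (N.+1 + z)%N.
  transitivity (\sum_(z < h.+1) e (N + z)%N); first by rewrite big_ord_recr.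
  rewrite big_ord_recl addn0; congr (_ + _).
  by apply: eq_bigr => z _; rewrite lift0 addSnnS.
lra.
Qed.

Lemma norm_sum_le1 e h : (forall z, `|e z| <= 1) -> `|\sum_(z < h) e z| <= h%:R.
Proof.
move=> e1; apply: le_trans (ler_norm_sum _ _ _) _.
rewrite -[h in h%:R]card_ord -sumr_const; apply: ler_sum => z _; exact: e1.
Qed.

Lemma norm_sum_shift e h N : (forall z, `|e z| <= 1) ->
  `|\sum_(z < N) (e (z + h)%N - e z)| <= 2 * h%:R.
Proof.
move=> e1; rewrite sum_shift; apply: le_trans (ler_normB _ _) _.
have := norm_sum_le1 h e1; have := norm_sum_le1 h (fun z => e1 (N + z)%N).
lra.
Qed.

(** By [fracD] each increment [d z] is [s] or [s - 1], so its absolute value is an affine function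
    of [d z]. The linear part telescopes up to [h] terms at each end; [frac_dist_int] bounds the
    constant part. *)
Lemma sum_frac_shift theta h (p : int) N :
  \sum_(z < N) `|frac ((z + h)%:R * theta) - frac (z%:R * theta)| <=
  2 * N%:R * `|h%:R * theta - p%:~R| + 2 * h%:R.
Proof.
pose s := frac (h%:R * theta); have [s0 s1] := (frac_ge0 (h%:R * theta), frac_lt1 (h%:R * theta)).
pose d z := frac ((z + h)%:R * theta) - frac (z%:R * theta).
have dE z : `|d z| = 2 * (s * (1 - s)) - (1 - 2 * s) * d z.
  have [E|E] := fracD (z%:R * theta) (h%:R * theta).
    have -> : d z = s by rewrite /d natrD mulrDl E /s; ring.
    by rewrite ger0_norm //; ring.
  have -> : d z = s - 1 by rewrite /d natrD mulrDl E /s; ring.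
  by rewrite ler0_norm; [ring | rewrite /s; lra].
under eq_bigr do rewrite -[frac _ - _]/(d _) dE.
rewrite sumrB sumr_const card_ord -mulr_sumr -mulr_natl.
have := @norm_sum_shift (fun z => frac (z%:R * theta)) h N (fun z => norm_frac_le1 _).
rewrite -/(\sum_(z < N) d z); set T := \sum_(z < N) d z => T1.
have le1 : - ((1 - 2 * s) * T) <= 2 * h%:R.
  apply: le_trans (ler_norm _) _; rewrite normrN normrM -[leRHS]mul1r.
  by apply: ler_pM => //; rewrite ler_norml /s; lra.
have le2 : N%:R * (s * (1 - s)) <= N%:R * `|h%:R * theta - p%:~R|.
  by rewrite ler_wpM2l // frac_dist_int.
have := ler0n R h; lra.
Qed.

(** Summation by parts: the shift passes from [e] to the fractional part at the cost of boundary
    terms, and [sum_frac_shift] bounds the rest. *)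
Lemma frac_correlation_shift e theta h (p : int) N : (forall z, `|e z| <= 1) ->
  `|\sum_(z < N) (e (z + h)%N - e z) * frac (z%:R * theta)| <=
  2 * N%:R * `|h%:R * theta - p%:~R| + 4 * h%:R.
Proof.
move=> e1; pose w z := frac (z%:R * theta).
have -> : \sum_(z < N) (e (z + h)%N - e z) * frac (z%:R * theta) =
    \sum_(z < N) (e (z + h)%N * w (z + h)%N - e z * w z) -
    \sum_(z < N) e (z + h)%N * (w (z + h)%N - w z).
  by rewrite -sumrB; apply: eq_bigr => z _; rewrite -/(w z); ring.
apply: le_trans (ler_normB _ _) _.
have le1 := @norm_sum_shift (fun z => e z * w z) h N
  (fun z => ltac:(by rewrite normrM mulr_ile1 // norm_frac_le1)).
have le2 : `|\sum_(z < N) e (z + h)%N * (w (z + h)%N - w z)| <=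
    2 * N%:R * `|h%:R * theta - p%:~R| + 2 * h%:R.
  apply: le_trans (ler_norm_sum _ _ _) (le_trans _ (sum_frac_shift theta h p N)).
  by apply: ler_sum => z _; rewrite normrM ler_piMl.
by move: le1 le2; rewrite /=; lra.
Qed.

Definition sine_correlation xi theta N : R :=
  \sum_(z < N) sin (2 * pi * (z%:R * xi)) * frac (z%:R * theta).

(* Shifting [z] by [h] rotates the pair of sine and cosine sums by the angle
   [2 pi h xi]; a vector that a rotation hardly moves is short. *)
Lemma sine_correlation_rotation xi theta h (p : int) N :
  `|sine_correlation xi theta N| * `|sin (pi * (h%:R * xi))| <=
  2 * N%:R * `|h%:R * theta - p%:~R| + 4 * h%:R.
Proof.
set B := leRHS; pose a := 2 * pi * (h%:R * xi); pose w z := frac (z%:R * theta).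
pose s z := sin (2 * pi * (z%:R * xi)); pose c z := cos (2 * pi * (z%:R * xi)).
pose S := sine_correlation xi theta N; pose C := \sum_(z < N) c z * w z.
have argD z : 2 * pi * ((z + h)%:R * xi) = 2 * pi * (z%:R * xi) + a.
  by rewrite /a natrD; ring.
have U : `|S * (cos a - 1) + C * sin a| <= B.
  have := @frac_correlation_shift s theta h p N (fun z => sin_max _).
  rewrite [X in `|X| <= _](_ : _ = S * (cos a - 1) + C * sin a) //.
  rewrite !mulr_suml -big_split /=; apply: eq_bigr => z _.
  by rewrite /s argD sinD /c -/(w z); ring.
have V : `|C * (cos a - 1) - S * sin a| <= B.
  have := @frac_correlation_shift c theta h p N (fun z => cos_max _).
  rewrite [X in `|X| <= _](_ : _ = C * (cos a - 1) - S * sin a) //.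
  rewrite !mulr_suml -sumrB /=; apply: eq_bigr => z _.
  by rewrite /c argD cosD /s -/(w z); ring.
have B0 : 0 <= B by apply: le_trans U.
rewrite -normrM -ler_sqr ?nnegrE // real_normK ?num_real //.
have U2 : (S * (cos a - 1) + C * sin a) ^+ 2 <= B ^+ 2.
  by rewrite -[leLHS]real_normK ?num_real // ler_sqr ?nnegrE.
have V2 : (C * (cos a - 1) - S * sin a) ^+ 2 <= B ^+ 2.
  by rewrite -[leLHS]real_normK ?num_real // ler_sqr ?nnegrE.
have a2 : cos a = 1 - 2 * sin (pi * (h%:R * xi)) ^+ 2.
  have := cos_mulr2n (pi * (h%:R * xi)); have := cos2Dsin2 (pi * (h%:R * xi)).
  have -> : (pi * (h%:R * xi)) *+ 2 = a by rewrite /a; ring.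
  lra.
have := cos2Dsin2 a; move: U2 V2 a2; rewrite -/S.
set x := cos a; set y := sin a; set t := sin _ => U2 V2 xt xy.
(* The rotation by [a] minus the identity multiplies squared lengths by [2 - 2 * cos a], which is
   [4 * t ^+ 2]. *)
have E : (S * (x - 1) + C * y) ^+ 2 + (C * (x - 1) - S * y) ^+ 2 =
   4 * (S * t) ^+ 2 + 4 * (C * t) ^+ 2.
  transitivity ((S ^+ 2 + C ^+ 2) * (x ^+ 2 + y ^+ 2 + 1 - 2 * x)); first ring.
  by rewrite xy xt; ring.
have := sqr_ge0 (C * t); have := sqr_ge0 B; lra.
Qed.

End FractionalPart.

(** * Diophantine approximation and asymptotics of the correlations *)

Section Diophantine.
Variable R : realType.
Implicit Types x xi theta : R.

Lemma rational_of_eq x (a b : int) : b != 0 -> b%:~R * x = a%:~R -> rational x.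
Proof.
move=> b0 bx; exists (a%:~R / b%:~R) => //.
by rewrite fmorph_div /= !ratr_int -bx mulrC mulKf // intr_eq0.
Qed.

Lemma rational_int (n : int) : rational (n%:~R : R).
Proof. by apply: (@rational_of_eq _ n 1) => //; rewrite mul1r. Qed.

Lemma rational_lin x xi (n l : int) :
  xi = n%:~R * x + l%:~R -> rational x -> rational xi.
Proof.
move=> -> [q _ <-]; exists (n%:~R * q + l%:~R) => //.
by rewrite rmorphD rmorphM /= !ratr_int.
Qed.

Lemma sinpi_neq0 x : ~ rational x -> sin (pi * x) != 0.
Proof.
move=> xirr; apply/negP => /eqP s0; apply: xirr.
have [q] := dist_int_le_sinpi x.
rewrite s0 normr0 normr_le0 subr_eq0 => /eqP ->; exact: rational_int.
Qed.

(** Pigeonhole: two of the first [N + 1] multiples of [theta] have fractional parts in the same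
    interval of length [1 / N < eps]. *)
Lemma dirichlet theta (eps : R) : 0 < eps ->
  exists (h : nat) (p : int), (0 < h)%N /\ `|h%:R * theta - p%:~R| < eps.
Proof.
move=> e0; pose N := (Num.truncn eps^-1).+1.
have N0 : 0 < N%:R :> R by rewrite ltr0n.
pose f z := Num.truncn (N%:R * frac (z%:R * theta)).
have fge z : (f z)%:R <= N%:R * frac (z%:R * theta).
  by rewrite truncn_le mulr_ge0 ?frac_ge0 // ltW.
have flt z : N%:R * frac (z%:R * theta) < (f z)%:R + 1.
  by rewrite natr1 truncnS_gt.
have [x [y [xy fxy]]] : exists x y : nat, (x < y)%N /\ f x = f y.
  apply: contrapT => H.
  have finj : {in `I_N.+1 &, injective f}.
    move=> x y _ _ fxy; apply: contrapT => xy; apply: H.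
    by case: (ltngtP x y) => // lt; [exists x, y | exists y, x].
  suff /(pigeonhole finj) : [set f x | x in `I_N.+1] `<=` `I_N by rewrite ltnn.
  move=> _ [x _ <-] /=; rewrite -(ltr_nat R); apply: le_lt_trans (fge x) _.
  by rewrite gtr_pMr // frac_lt1.
exists (y - x)%N, (Num.floor (y%:R * theta) - Num.floor (x%:R * theta)).
rewrite subn_gt0 xy; split=> //.
have -> : (y - x)%:R * theta - (Num.floor (y%:R * theta) - Num.floor (x%:R * theta))%:~R =
    frac (y%:R * theta) - frac (x%:R * theta).
  by rewrite natrB ?(ltnW xy) // intrB /frac; ring.
have Ne : 1 < N%:R * eps by rewrite -ltr_pdivrMr // div1r truncnS_gt.
rewrite -(ltr_pM2l N0) -[X in X * `|_|](gtr0_norm N0) -normrM.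
apply: lt_trans Ne; rewrite mulrBr ltr_norml.
by have := fge x; have := fge y; have := flt x; have := flt y; rewrite fxy; lra.
Qed.

Lemma int_ball_min (f : int -> R) (M : nat) : (forall n, 0 < f n) ->
  exists2 mu, 0 < mu & forall n : int, (absz n <= M)%N -> mu <= f n.
Proof.
move=> f0; elim: M => [|M [mu mu0 IH]].
  by exists (f 0) => // n; rewrite leqn0 absz_eq0 => /eqP ->.
exists (Num.min mu (Num.min (f M.+1%:Z) (f (- M.+1%:Z)))); first by rewrite !lt_min mu0 !f0.
move=> n; rewrite leq_eqVlt => /orP[/eqP nM|/IH]; last by rewrite !ge_min => ->.
have [->|->] : n = M.+1%:Z \/ n = - M.+1%:Z by lia.
  by rewrite !ge_min lexx orbT.
by rewrite !ge_min lexx !orbT.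
Qed.

(** The integer [q] expresses the distance of [h xi] to the integers. When [h theta = p] the bound
    forces [h xi] to be an integer, so the map sending [h theta] to [h xi] modulo 1 is well
    defined. *)
Definition lipschitz_mod1 (C : R) xi theta := forall (h p : int),
  exists q : int, `|h%:~R * xi - q%:~R| <= C * `|h%:~R * theta - p%:~R|.

(* The step [eps] of [h] is tracked until the multiples of [eps] close up the
   circle, which makes [n], and until they reach [theta], which compares [xi]
   with [n theta]. *)
Lemma lipschitz_mod1_approx (C : R) xi theta (h p : int) : 0 < C ->
  let eps := h%:~R * theta - p%:~R in
  lipschitz_mod1 C xi theta -> 0 < eps < 1 ->
  exists n q : int, `|n%:~R| <= 2 * C /\
    `|xi + q%:~R - n%:~R * theta| <= C * eps * (2 * `|theta| + 3).
Proof.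
move=> C0 eps L /andP[e0 e1].
pose k := Num.floor eps^-1; pose r := 1 - k%:~R * eps.
pose k2 := Num.floor (theta / eps); pose r2 := theta - k2%:~R * eps.
have k0 : 0 <= k%:~R :> R by rewrite ler0z floor_ge0 invr_ge0 ltW.
have mod_eps (x : R) : 0 <= x - (Num.floor (x / eps))%:~R * eps <= eps.
  have -> : x - (Num.floor (x / eps))%:~R * eps = frac (x / eps) * eps.
    by rewrite /frac mulrBl divfK // gt_eqF.
  by rewrite mulr_ge0 ?frac_ge0 ?(ltW e0) //= ler_piMl ?(ltW e0) // ltW // frac_lt1.
have /andP[r0 re] : 0 <= r <= eps by have := mod_eps 1; rewrite div1r.
have /andP[r20 r2e] : 0 <= r2 <= eps by exact: mod_eps.
have [q] := L h p; rewrite -/eps (gtr0_norm e0); set e' := _ - _ => e'C.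
(* The point [k * eps - 1 = - r] is small, so [k * e'] lies within [C * r] of an integer, which is
   [n]. *)
have [q1] := L (k * h) (k * p + 1).
rewrite (_ : `|(k * h)%:~R * theta - _| = r); last first.
  by rewrite -[RHS]ger0_norm // -normrN /r /eps intrD !intrM; congr `| _ |; ring.
pose n := q1 - k * q; rewrite (_ : _ - _ = k%:~R * e' - n%:~R); last first.
  by rewrite /e' /n intrB !intrM; ring.
move=> nE.
(* Likewise [k2 * eps - theta = - r2] is small, so [k2 * e' - xi] lies within [C * r2] of the
   integer [q3]. *)
have [q2] := L (k2 * h - 1) (k2 * p).
rewrite (_ : `|(k2 * h - 1)%:~R * theta - _| = r2); last first.
  by rewrite -[RHS]ger0_norm // -normrN /r2 /eps intrB !intrM; congr `| _ |; ring.
pose q3 := q2 - k2 * q; rewrite (_ : _ - _ = k2%:~R * e' - xi - q3%:~R); last first.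
  by rewrite /e' /q3 !intrB !intrM; ring.
move=> qE; exists n, q3.
have keps : k%:~R * eps <= 1 by rewrite /r in r0; lra.
have ke' : `|k%:~R * e'| <= C.
  rewrite normrM (ger0_norm k0).
  apply: le_trans (ler_wpM2l k0 e'C) _.
  by rewrite mulrCA ler_piMr // ltW.
have Cr : C * r <= C * eps by rewrite ler_wpM2l // ltW.
have Cr2 : C * r2 <= C * eps by rewrite ler_wpM2l // ltW.
have CeC : C * eps <= C by rewrite ler_piMr // ltW.
split.
  have -> : n%:~R = k%:~R * e' - (k%:~R * e' - n%:~R) by ring.
  by apply: le_trans (ler_normB _ _) _; lra.
(* Writing [1 = k * eps + r] and [theta = k2 * eps + r2] in [k2 * e' - k * e' * theta] cancels the
   main terms and leaves the last bracket. *)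
have -> : xi + q3%:~R - n%:~R * theta = - (k2%:~R * e' - xi - q3%:~R) +
   (k%:~R * e' - n%:~R) * theta + (k2%:~R * e' * r - k%:~R * e' * r2).
  by rewrite /r /r2; ring.
have le1 : `|(k%:~R * e' - n%:~R) * theta| <= C * eps * `|theta|.
  by rewrite normrM ler_wpM2r //; lra.
have le2 : `|k2%:~R * e' * r| <= C * eps * (`|theta| + 1).
  have k2e : `|k2%:~R * eps| <= `|theta| + 1.
    have -> : k2%:~R * eps = theta - r2 by rewrite /r2; ring.
    by apply: le_trans (ler_normB _ _) _; rewrite (ger0_norm r20); lra.
  rewrite !normrM (ger0_norm r0).
  apply: (@le_trans _ _ (`|k2%:~R| * (C * eps) * eps)).
    by apply: ler_pM => //; rewrite ?mulr_ge0 // ler_wpM2l.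
  rewrite normrM (gtr0_norm e0) in k2e.
  have -> : `|k2%:~R| * (C * eps) * eps = C * eps * (`|k2%:~R| * eps) by ring.
  by rewrite ler_wpM2l // mulr_ge0 // ltW.
have le3 : `|k%:~R * e' * r2| <= C * eps.
  by rewrite normrM (ger0_norm r20) ler_pM.
apply: le_trans (ler_normD _ _) _; apply: le_trans (lerD (ler_normD _ _) (ler_normB _ _)) _.
by rewrite normrN; lra.
Qed.

(* A homomorphism from [Z theta + Z] to [R / Z] that is Lipschitz modulo the
   integers extends to the circle, hence is multiplication by an integer. *)
Lemma lipschitz_mod1_lin (C : R) xi theta : 0 < C -> ~ rational xi ->
  lipschitz_mod1 C xi theta -> exists n l : int, xi = n%:~R * theta + l%:~R.
Proof.
move=> C0 xiirr L; apply: contrapT => H.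
have [[q _ thE]|thirr] := pselect (rational theta).
  (* With the denominator as [h] and the numerator as [p] the bound is zero, so a nonzero multiple
     of [xi] is an integer. *)
  have d0 : (denq q)%:~R != 0 :> R by rewrite intr_eq0 denq_neq0.
  have [a] := L (denq q) (numq q).
  have -> : (denq q)%:~R * theta - (numq q)%:~R = 0.
    by apply/eqP; rewrite subr_eq0 -thE /ratr mulrC divfK.
  rewrite normr0 mulr0 normr_le0 subr_eq0 => /eqP /rational_of_eq.
  by move=> /(_ (denq_neq0 q)).
(* By [frac_dist_int], [f n] is at most the distance from [xi - n * theta] to the integers. It is
   positive by [H], and uniformly so over the finitely many [n] with [|n| <= 2 * C]. *)
pose f n := frac (xi - n%:~R * theta) * (1 - frac (xi - n%:~R * theta)).
have f0 n : 0 < f n.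
  apply: mulr_gt0; last by rewrite subr_gt0 frac_lt1.
  rewrite lt_neqAle frac_ge0 andbT eq_sym.
  apply/negP => /eqP f0; apply: H; exists n, (Num.floor (xi - n%:~R * theta)).
  by rewrite -[LHS](subrK (n%:~R * theta)) addrC; congr (_ + _); apply/eqP;
     rewrite -subr_eq0 -/(frac _) f0.
have [mu mu0 muP] := int_ball_min (Num.truncn (2 * C)) f0.
(* [T] is the factor of [eps] in [lipschitz_mod1_approx], so that a step below [mu / T] brings
   [xi - n * theta] closer than [mu] to an integer. *)
pose T := C * (2 * `|theta| + 3).
have T0 : 0 < T by rewrite mulr_gt0 // ltr_wpDl // mulr_ge0.
have [h [p [h0]]] : exists (h : nat) (p : int), (0 < h)%N /\
    `|h%:R * theta - p%:~R| < Num.min 1 (mu / T).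
  by apply: dirichlet; rewrite lt_min ltr01 divr_gt0.
rewrite lt_min => /andP[lt1 ltmu].
have [h' [p' hE]] : exists h' p' : int, h'%:~R * theta - p'%:~R = `|h%:R * theta - p%:~R|.
  have [hp|hp] := leP 0 (h%:R * theta - p%:~R).
    by exists h%:Z, p; rewrite ger0_norm // -pmulrn.
  by exists (- h%:Z), (- p); rewrite ltr0_norm // !mulrNz -pmulrn; ring.
have e0 : 0 < `|h%:R * theta - p%:~R|.
  rewrite normr_gt0 subr_eq0; apply/negP => /eqP hp; apply: thirr.
  by apply: (@rational_of_eq _ p h%:Z); rewrite -?pmulrn // -lt0n.
have := @lipschitz_mod1_approx C xi theta h' p' C0 L; rewrite hE => /(_ ltac:(by rewrite e0)).
case=> n [q [nC nq]].
have /muP : (absz n <= Num.truncn (2 * C))%N.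
  rewrite truncn_ge_nat; last by rewrite mulr_ge0 // ltW.
  by rewrite natr_absz intr_norm.
have := frac_dist_int (xi - n%:~R * theta) (- q); rewrite -/(f n).
rewrite mulrNz opprK addrAC => d1 d2.
have : C * `|h%:R * theta - p%:~R| * (2 * `|theta| + 3) < mu.
  by rewrite mulrAC -/T mulrC -ltr_pdivlMr.
lra.
Qed.

(* If this failed, dividing [sine_correlation_rotation] by [N] along a sequence
   would make [h theta |-> h xi] Lipschitz modulo 1. *)
Lemma sine_correlation_small xi theta (eps : R) : ~ rational xi ->
  ~ (exists n l : int, xi = n%:~R * theta + l%:~R) -> 0 < eps ->
  exists N0, forall N, (N0 <= N)%N ->
    `|sine_correlation xi theta N| <= eps * N%:R.
Proof.
move=> xiirr nlin e0; apply: contrapT => H; apply: nlin.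
have H' N0 : exists2 N, (N0 <= N)%N & eps * N%:R < `|sine_correlation xi theta N|.
  apply: contrapT => H'; apply: H; exists N0 => N N0N.
  by rewrite leNgt; apply/negP => lt; apply: H'; exists N.
have small (h : nat) (p : int) :
    eps * `|sin (pi * (h%:R * xi))| <= 2 * `|h%:R * theta - p%:~R|.
  rewrite leNgt -subr_gt0; apply/negP; set d := _ - _ => d0.
  (* [N] is so large that [N * d] exceeds the boundary term [4 * h] of the rotation bound. *)
  have [N NN ltN] := H' (Num.truncn (4 * h%:R / d)).+1.
  have Nd : 4 * h%:R < N%:R * d.
    rewrite -ltr_pdivrMr //; apply: lt_le_trans (truncnS_gt _) _.
    by rewrite ler_nat.
  have := sine_correlation_rotation xi theta h p N.
  have : eps * N%:R * `|sin (pi * (h%:R * xi))| <=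
      `|sine_correlation xi theta N| * `|sin (pi * (h%:R * xi))|.
    by rewrite ler_wpM2r // ltW.
  have -> : eps * N%:R * `|sin (pi * (h%:R * xi))| =
      N%:R * d + 2 * N%:R * `|h%:R * theta - p%:~R| by rewrite /d; ring.
  lra.
apply: (@lipschitz_mod1_lin (2 / eps)) => //; first by rewrite divr_gt0.
have Lnat (h : nat) (p : int) : exists q : int,
    `|h%:R * xi - q%:~R| <= 2 / eps * `|h%:R * theta - p%:~R|.
  have [q qP] := dist_int_le_sinpi (h%:R * xi); exists q; apply: le_trans qP _.
  by rewrite mulrAC ler_pdivlMr // mulrC.
case=> h p; first by have [q] := Lnat h p; exists q.
have [q qP] := Lnat h.+1 (- p); exists (- q); rewrite NegzE !mulrNz -pmulrn.
rewrite mulrNz in qP.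
have -> : - h.+1%:R * xi - - q%:~R = - (h.+1%:R * xi - q%:~R) by ring.
have -> : - h.+1%:R * theta - p%:~R = - (h.+1%:R * theta - - p%:~R) by ring.
by rewrite !normrN.
Qed.

(** Multiplying by [2 * sin (a / 2)] turns the sum into a telescoping difference of cosines. *)
Lemma sum_sin_bounded (a b : R) N : sin (a / 2) != 0 ->
  `|\sum_(z < N) sin (z%:R * a + b)| <= `|sin (a / 2)|^-1.
Proof.
move=> s0.
have E : 2 * sin (a / 2) * \sum_(z < N) sin (z%:R * a + b) =
    cos (b - a / 2) - cos (N%:R * a + b - a / 2).
  elim: N => [|N IH]; first by rewrite big_ord0 mul0r add0r; ring.
  rewrite big_ord_recr mulrDr IH /=.
  have -> : N.+1%:R * a + b - a / 2 = N%:R * a + b + a / 2 by rewrite -natr1; field.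
  by rewrite (cosB (N%:R * a + b)) (cosD (N%:R * a + b)); ring.
have s1 : 0 < `|sin (a / 2)| by rewrite normr_gt0.
rewrite -[leRHS]mul1r ler_pdivlMr // mulrC.
have : `|2 * sin (a / 2) * \sum_(z < N) sin (z%:R * a + b)| <= 2.
  rewrite E; apply: le_trans (ler_normB _ _) _.
  by have := cos_max (b - a / 2); have := cos_max (N%:R * a + b - a / 2); lra.
by rewrite !normrM (ger0_norm (ler0n R 2)) -mulrA; lra.
Qed.

(** [sin2pi_frac] bounds each term by a sine, a cosine of the doubled angle and the constant
    [- 1 / (4 * pi)]. Irrationality of [xi] and [2 * xi] keeps the two oscillating sums bounded. *)
Lemma sine_correlation_diag xi : ~ rational xi -> exists c B : R,
  0 < c /\ forall N, sine_correlation xi xi N <= B - c * N%:R.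
Proof.
move=> xiirr; have p0 := @pi_gt0 R.
have xi2irr : ~ rational (2 * xi).
  case=> q _ qE; apply: xiirr; exists (q / 2) => //.
  by rewrite fmorph_div /= qE ratr_nat mulrC mulKf // pnatr_eq0.
pose c := (4 * pi)^-1 : R; have c0 : 0 < c by rewrite invr_gt0 mulr_gt0.
exists c, (`|sin (pi * xi)|^-1 / 2 + c * `|sin (pi * (2 * xi))|^-1); split=> // N.
have b1 : `|\sum_(z < N) sin (2 * pi * (z%:R * xi))| <= `|sin (pi * xi)|^-1.
  have := @sum_sin_bounded (2 * pi * xi) 0 N.
  have -> : 2 * pi * xi / 2 = pi * xi by field.
  move=> /(_ (sinpi_neq0 xiirr)); congr (`| _ | <= _).
  by apply: eq_bigr => z _; congr sin; ring.
have b2 : `|\sum_(z < N) cos (4 * pi * (z%:R * xi))| <= `|sin (pi * (2 * xi))|^-1.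
  have := @sum_sin_bounded (4 * pi * xi) (pi / 2) N.
  have -> : 4 * pi * xi / 2 = pi * (2 * xi) by field.
  move=> /(_ (sinpi_neq0 xi2irr)); congr (`| _ | <= _).
  by apply: eq_bigr => z _; rewrite sinDpihalf; congr cos; ring.
have : sine_correlation xi xi N <= \sum_(z < N)
    (sin (2 * pi * (z%:R * xi)) / 2 + c * cos (4 * pi * (z%:R * xi)) - c).
  apply: ler_sum => z _; set x := z%:R * xi.
  have := sin2pi_frac x.
  have -> : sin (2 * pi * x) ^+ 2 / (2 * pi) = c - c * cos (4 * pi * x).
    have := cos_mulr2n (2 * pi * x); have := cos2Dsin2 (2 * pi * x).
    have -> : (2 * pi * x) *+ 2 = 4 * pi * x by ring.
    move=> e1 e2; have -> : sin (2 * pi * x) ^+ 2 = (1 - cos (4 * pi * x)) / 2 by lra.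
    rewrite /c; set C := cos _; move: p0; move: (pi : R) => P P0.
    by field; exact: lt0r_neq0.
  lra.
rewrite big_split /= sumrN sumr_const card_ord big_split /= -mulr_suml -mulr_sumr -[c *+ N]mulr_natr.
have le2 : c * \sum_(z < N) cos (4 * pi * (z%:R * xi)) <= c * `|sin (pi * (2 * xi))|^-1.
  by rewrite ler_wpM2l ?(ltW c0) // (le_trans (ler_norm _)).
have le1 := le_trans (ler_norm _) b1.
lra.
Qed.

End Diophantine.

(** * Existence of two slopes with integer sum *)

Section OppositePair.
Variables (R : realType) (I : finType) (theta : I -> R).

Lemma eventually_all (P : I -> nat -> Prop) :
  (forall i, exists N0, forall N, (N0 <= N)%N -> P i N) ->
  exists N0, forall N, (N0 <= N)%N -> forall i, P i N.
Proof.
move=> /choice[f fP]; exists (\max_i f i)%N => N lefN i.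
by apply: fP; apply: leq_trans lefN; exact: leq_bigmax.
Qed.

(** Maximality of [Z theta_i + Z] is obtained by minimizing the number of [j] above [i]. If [j] is
    above [i], the sets of indices above them agree, so [i] is above [j] as well. *)
Lemma exists_maximal_irrational : (exists i, ~ rational (theta i)) ->
  exists2 i, ~ rational (theta i) & forall j (n l : int),
    theta i = n%:~R * theta j + l%:~R -> exists l' : int,
    theta j = theta i + l'%:~R \/ theta i + theta j = l'%:~R.
Proof.
pose below i j := `[< exists n l : int, theta i = n%:~R * theta j + l%:~R >].
have below_refl i : below i i.
  by apply/asboolP; exists 1, 0; rewrite mul1r addr0.
have below_trans i j k : below i j -> below j k -> below i k.
  move=> /asboolP[n [l ij]] /asboolP[n' [l' jk]]; apply/asboolP.
  by exists (n * n'), (n * l' + l); rewrite ij jk intrD !intrM; ring.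
case=> i0 /asboolP irr0.
have [i /asboolP irr imin] := @arg_minnP I i0 (fun i => `[< ~ rational (theta i) >])
  (fun i => #|[set j | below i j]%SET|) irr0.
exists i => // j n l ij.
have bij : below i j by apply/asboolP; exists n, l.
have sub : [set k | below j k]%SET \subset [set k | below i k]%SET.
  by apply/fintype.subsetP => k; rewrite !finset.in_set; exact: below_trans bij.
have jirr : ~ rational (theta j) by move=> jrat; apply: irr; exact: rational_lin ij jrat.
have : i \in [set k | below j k]%SET.
  have /eqP -> : [set k | below j k]%SET == [set k | below i k]%SET.
    by rewrite eqEcard sub imin //; apply/asboolP.
  by rewrite finset.in_set.
rewrite finset.in_set => /asboolP[n' [l' ji]].
(* Otherwise the two relations combine into a nontrivial integer equation for the irrational
   [theta j]. *)
have n1 : 1 - n' * n = 0.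
  apply/eqP; apply: contrapT => /negP n1; apply: jirr.
  apply: (@rational_of_eq _ _ (n' * l + l') _ n1).
  rewrite intrB intrD !intrM mulrBl mul1r {1}ji ij; ring.
have : (absz n' * absz n)%N == 1%N by rewrite -abszM; lia.
rewrite muln_eq1 => /andP[_ /eqP an1]; have : n = 1 \/ n = -1 by lia.
by case=> nE; [exists (- l); left | exists l; right];
  rewrite ij nE ?mulrNz; ring.
Qed.

Lemma exists_opposite_pair (c : R) (z0 : nat) :
  (forall z, (z0 <= z)%N -> \sum_i frac (z%:R * theta i) = c) ->
  (exists i, ~ rational (theta i)) ->
  exists i j (l : int), ~ rational (theta i) /\ theta i + theta j = l%:~R.
Proof.
move=> sumc /exists_maximal_irrational[i irr imax]; apply: contrapT => nopp.
have oppF j (l : int) : theta i + theta j <> l%:~R.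
  by move=> E; apply: nopp; exists i, j, l.
pose same j := `[< exists l : int, theta j = theta i + l%:~R >].
have sameE j N : same j -> sine_correlation (theta i) (theta j) N =
    sine_correlation (theta i) (theta i) N.
  move=> /asboolP[l ->]; apply: eq_bigr => z _; congr (_ * _).
  by rewrite mulrDr (_ : z%:R * l%:~R = (z%:Z * l)%:~R) ?fracDint // intrM -pmulrn.
have [d [B [d0 diag]]] := sine_correlation_diag irr.
(* Chosen so that fewer than [#|I|.+1] error terms [eps * N] use up at most half of the decrease
   [d * N]. *)
pose eps := d / (2 * (#|I|.+1)%:R).
have eps0 : 0 < eps by rewrite divr_gt0 // mulr_gt0.
have [N1 N1P] : exists N0, forall N, (N0 <= N)%N -> forall j, ~~ same j ->
    `|sine_correlation (theta i) (theta j) N| <= eps * N%:R.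
  apply: eventually_all => j; case: (boolP (same j)) => [_|nsame]; first by exists 0%N.
  have [||N0 N0P] := @sine_correlation_small _ (theta i) (theta j) _ _ _ eps0 => //.
    move=> [n [l /imax[l' [E|E]]]]; last exact: oppF E.
    by move/negP: nsame; apply; apply/asboolP; exists l'.
  by exists N0 => N /N0P.
pose e z := sin (2 * pi * (z%:R * theta i)).
pose F z := \sum_j frac (z%:R * theta j).
have total N : \sum_j sine_correlation (theta i) (theta j) N = \sum_(z < N) e z * F z.
  by rewrite exchange_big; apply: eq_bigr => z _; rewrite -mulr_sumr.
(* In [F z = (F z - c) + c] the first part vanishes from [z0] on, and the constant part meets
   bounded sine sums. *)
have [B' B'P] : exists B', forall N, B' <= \sum_(z < N) e z * F z.
  pose K := \sum_(z < z0) `|e z * (F z - c)|.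
  have ebound N : `|\sum_(z < N) e z| <= `|sin (pi * theta i)|^-1.
    have := @sum_sin_bounded _ (2 * pi * theta i) 0 N.
    have -> : 2 * pi * theta i / 2 = pi * theta i by field.
    move=> /(_ (sinpi_neq0 irr)); congr (`| _ | <= _).
    by apply: eq_bigr => z _; congr sin; ring.
  exists (- (K + `|c| * `|sin (pi * theta i)|^-1)) => N.
  have -> : \sum_(z < N) e z * F z =
      \sum_(z < N) e z * (F z - c) + c * \sum_(z < N) e z.
    by rewrite mulr_sumr -big_split; apply: eq_bigr => z _ /=; ring.
  have le1 : `|c * \sum_(z < N) e z| <= `|c| * `|sin (pi * theta i)|^-1.
    by rewrite normrM ler_wpM2l.
  have le2 : `|\sum_(z < N) e z * (F z - c)| <= K.
    apply: le_trans (ler_norm_sum _ _ _) _; rewrite /K.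
    rewrite -(big_mkord xpredT (fun z => `|e z * (F z - c)|)).
    rewrite -(big_mkord xpredT (fun z => `|e z * (F z - c)|)).
    have [le|lt] := leqP N z0.
      by rewrite [leRHS](@big_cat_nat _ _ _ N) //= lerDl sumr_ge0.
    rewrite (@big_cat_nat _ _ _ z0) ?(ltnW lt) //= gerDl big_nat_cond big1 //.
    by move=> z /andP[/andP[/sumc zc _] _]; rewrite /F zc subrr mulr0 normr0.
  by move: le1 le2; rewrite !ler_norml => /andP[? _] /andP[? _]; lra.
have upper N : (N1 <= N)%N -> B <= d * N%:R ->
    \sum_j sine_correlation (theta i) (theta j) N <= B - d / 2 * N%:R.
  move=> N1N BN; rewrite (bigD1 i) //=.
  have : \sum_(j | j != i) sine_correlation (theta i) (theta j) N <=
      \sum_(j | j != i) eps * N%:R.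
    (* A term in the class of [i] is at most [B - d * N <= 0], hence also below [eps * N]. *)
    apply: ler_sum => j _; case: (boolP (same j)) => [/sameE ->|].
      apply: le_trans (diag N) _.
      by apply: le_trans (_ : 0 <= _); [lra | rewrite mulr_ge0 // ltW].
    by move=> /(N1P N N1N); exact: le_trans (ler_norm _).
  have : \sum_(j | j != i) eps * N%:R <= d / 2 * N%:R.
    rewrite sumr_const -mulrnAl; apply: ler_wpM2r => //.
    have -> : d / 2 = eps *+ #|I|.+1.
      by rewrite /eps -[RHS]mulr_natr invfM mulrA mulfVK // pnatr_eq0.
    by rewrite ler_pMn2l // (leq_trans (max_card _)).
  by have := diag N; lra.
pose N := maxn N1 (maxn (Num.truncn (B / d)).+1 (Num.truncn ((B - B') / (d / 2))).+1).
have d20 : 0 < d / 2 by rewrite divr_gt0.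
have BN : B < d * N%:R.
  rewrite mulrC -ltr_pdivrMr //; apply: lt_le_trans (truncnS_gt _) _.
  by rewrite ler_nat /N !leq_max leqnn orbT.
have BN' : B - B' < d / 2 * N%:R.
  rewrite [ltRHS]mulrC -ltr_pdivrMr //; apply: lt_le_trans (truncnS_gt _) _.
  by rewrite ler_nat /N !leq_max leqnn !orbT.
have := upper N (leq_maxl _ _) (ltW BN); rewrite total.
by have := B'P N; lra.
Qed.

End OppositePair.

(** * Multiplicities in Beatty sequences, and reducibility *)

Section BeattyCovers.
Variable R : realType.

(** The equation [floor (n alpha) = z] means [z / alpha <= n < (z + 1) / alpha], so [n] runs between
    two consecutive values of [b]; [z > 0] excludes [n = 0]. Turning ceilings into floors introduces
    the negative slope. *)
Lemma beatty0E (alpha : R) (z : nat) : 0 < alpha -> (0 < z)%N ->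
  (beatty alpha 0 z%:Z)%:R = alpha^-1 +
    (frac (z.+1%:R * - alpha^-1) - frac (z%:R * - alpha^-1)).
Proof.
move=> a0 z0; pose b z := absz (Num.ceil (z%:R / alpha)).
have bE y : (b y)%:Z = Num.ceil (y%:R / alpha).
  by rewrite gez0_abs // ceil_ge0 (@lt_le_trans _ _ 0) ?ltrN10 // divr_ge0 // ltW.
have fiberE : beatty_fiber alpha 0 z%:Z = [set` [fset n in iota (b z) (b z.+1 - b z)]%fset].
  apply/seteqP; split=> n /=; rewrite !inE mem_iota subnKC; last first.
  - by rewrite -lez_nat !bE le_ceil // ler_pM2r ?invr_gt0 // ler_nat.
  - rewrite -lez_nat -ltz_nat !bE ceil_le_int ceil_gt_int -!pmulrn.
    rewrite ler_pdivrMr // ltr_pdivlMr // => /andP[zn nz]; split.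
      rewrite lt0n; apply/negP => /eqP n0; move: zn; rewrite n0 mul0r.
      by rewrite lern0 => /eqP z00; rewrite z00 in z0.
    by apply/eqP; rewrite addr0 floor_eq zn intrD -pmulrn natr1.
  - by rewrite -lez_nat !bE le_ceil // ler_pM2r ?invr_gt0 // ler_nat.
  - move=> [n0 /eqP]; rewrite addr0 floor_eq intrD -pmulrn natr1 => /andP[zn nz].
    rewrite -lez_nat -ltz_nat !bE ceil_le_int ceil_gt_int -!pmulrn.
    by rewrite ler_pdivrMr // ltr_pdivlMr // zn nz.
rewrite /beatty fiberE set_fsetK card_fseq undup_id ?iota_uniq // size_iota natrB; last first.
  by rewrite -lez_nat !bE le_ceil // ler_pM2r ?invr_gt0 // ler_nat.
have bR y : (b y)%:R = - (Num.floor (y%:R * - alpha^-1))%:~R :> R.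
  by rewrite pmulrn bE ceilNfloor mulrNz mulrN.
rewrite !bR /frac; set f := (Num.floor _)%:~R; set g := (Num.floor _)%:~R.
by rewrite -natr1; ring.
Qed.

(** The total multiplicity at [z] is [s + F (z + 1) - F z]. If it is eventually [m], then [F]
    becomes an arithmetic progression of step [m - s], and boundedness of [F] forces [m = s]. *)
Lemma is_eec_beattyP (I : finType) (alpha : I -> R) (J : {set I}) (m : nat) :
  (forall i, 0 < alpha i) ->
  is_eec (fun i => beatty (alpha i) 0) J m <->
  \sum_(i in J) (alpha i)^-1 = m%:R /\
  exists (z0 : nat) (c : R), forall z, (z0 <= z)%N ->
    \sum_(i in J) frac (z%:R * - (alpha i)^-1) = c.
Proof.
move=> a0; pose F z := \sum_(i in J) frac (z%:R * - (alpha i)^-1).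
have count z : (0 < z)%N -> (\sum_(i in J) beatty (alpha i) 0 z%:Z)%:R =
    \sum_(i in J) (alpha i)^-1 + (F z.+1 - F z).
  move=> z0; rewrite natr_sum -sumrB -big_split /=.
  by apply: eq_bigr => i _; rewrite beatty0E.
split=> [[z0 cover]|[sumE [z0 [c Fc]]]]; last first.
  exists z0%:Z => -[z|//]; rewrite ltz_nat lez_nat => zpos z0z.
  apply/eqP; rewrite -(eqr_nat R) count // sumE /F !Fc ?subrr ?addr0 //.
  exact: leqW.
pose Z := (absz z0).+1; set s := \sum_(i in J) _.
have step z : (Z <= z)%N -> F z.+1 = F z + (m%:R - s).
  move=> Zz; have zpos : (0 < z)%N by exact: leq_trans Zz.
  have z0z : z0 <= z%:Z by rewrite /Z in Zz; lia.
  by rewrite -(cover z%:Z) // count // -/s; ring.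
have iter n : F (Z + n)%N = F Z + n%:R * (m%:R - s).
  elim: n => [|n IH]; first by rewrite addn0 mul0r addr0.
  by rewrite addnS step ?leq_addr // IH -natr1; ring.
have Fbound z : `|F z| <= #|J|%:R.
  rewrite -sumr_const; apply: le_trans (ler_norm_sum _ _ _) _.
  by apply: ler_sum => i _; exact: norm_frac_le1.
have ms : m%:R - s = 0.
  apply/eqP; apply: contrapT => /negP; rewrite -normr_gt0 => d0.
  pose n := (Num.truncn (2 * #|J|%:R / `|m%:R - s|)).+1.
  have : 2 * #|J|%:R < n%:R * `|m%:R - s| by rewrite -ltr_pdivrMr // truncnS_gt.
  rewrite -[n%:R]ger0_norm // -normrM.
  have -> : n%:R * (m%:R - s) = F (Z + n)%N - F Z by rewrite iter; ring.
  apply/negP; rewrite -leNgt; apply: le_trans (ler_normB _ _) _.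
  by have := Fbound (Z + n)%N; have := Fbound Z; lra.
split; first by apply/esym/eqP; rewrite -subr_eq0 ms.
by exists Z, (F Z) => z Zz; rewrite -/(F z) -(subnKC Zz) iter ms mulr0 addr0.
Qed.

Lemma pair_is_eec (I : finType) (alpha : I -> R) (i j : I) (m : nat) :
  (forall i, 0 < alpha i) -> i != j -> ~ rational (alpha i) ->
  (alpha i)^-1 + (alpha j)^-1 = m%:R ->
  is_eec (fun i => beatty (alpha i) 0) [set i; j]%SET m.
Proof.
move=> a0 ij irr sumE; apply/is_eec_beattyP => //.
split; first by rewrite big_setU1 ?inE //= big_set1.
(* The threshold is 1 because at [z = 0] both fractional parts vanish and the sum is 0. *)
exists 1%N, 1 => z z1; rewrite big_setU1 ?inE //= big_set1.
have -> : z%:R * - (alpha j)^-1 = - (z%:R * - (alpha i)^-1) + (- (z * m)%N%:Z)%:~R.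
  by rewrite mulrNz -pmulrn natrM -sumE; ring.
rewrite fracDint fracN; first ring.
apply/negP => /eqP; rewrite /frac => /eqP; rewrite subr_eq0 => /eqP E.
apply: irr; apply: (@rational_of_eq _ _ (- z%:Z) (Num.floor (z%:R * - (alpha i)^-1))).
  by rewrite -(intr_eq0 R) -E mulf_neq0 ?oppr_eq0 ?invr_neq0 ?gt_eqF ?ltr0n.
by rewrite -E mulrNz -pmulrn mulrN mulNr mulfVK // gt_eqF.
Qed.

(** Both parts of a reduction are nonempty, hence singletons. The one containing [i] would make the
    inverse of [alpha i] an integer. *)
Lemma irrational_pair_irreducible (I : finType) (alpha : I -> R) (i j : I) (m : nat) :
  (forall i, 0 < alpha i) -> [set: I]%SET = [set i; j]%SET -> i != j ->
  ~ rational (alpha i) -> (alpha i)^-1 + (alpha j)^-1 = m%:R ->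
  irreducible_eec (fun i => beatty (alpha i) 0) m.
Proof.
move=> a0 IE ij irr sumE; split; first by rewrite IE; exact: pair_is_eec.
case=> _ [m1 [m2 [J [K [[m10 m20 _] [JK disJK eecJ eecK]]]]]].
have ne (L : {set I}) (p : nat) : (0 < p)%N ->
    is_eec (fun i => beatty (alpha i) 0) L p -> (0 < #|L|)%N.
  move=> p0 /(is_eec_beattyP _ _ a0)[sL _]; rewrite card_gt0.
  by apply: contraTneq p0 => L0; move: sL; rewrite L0 big_set0 => /esym/eqP;
    rewrite pnatr_eq0 => /eqP ->.
have card2 : (#|J| + #|K| = 2)%N.
  move: disJK; rewrite -leq_card_setU JK => /eqP <-.
  by rewrite IE cards2 ij.
have [J0 K0] := (ne _ _ m10 eecJ, ne _ _ m20 eecK).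
have single (L : {set I}) (p : nat) : is_eec (fun i => beatty (alpha i) 0) L p ->
    #|L| = 1%N -> i \notin L.
  move=> /(is_eec_beattyP _ _ a0)[sL _] /eqP/cards1P[x Lx]; rewrite Lx inE.
  apply/negP => /eqP xi; apply: irr; move: sL; rewrite Lx big_set1 -xi => aE.
  apply: (@rational_of_eq _ _ 1 p).
    by rewrite -(intr_eq0 R) -pmulrn -aE invr_neq0 // gt_eqF.
  by rewrite -pmulrn -aE mulVf // gt_eqF.
have iJ := single _ _ eecJ ltac:(lia); have iK := single _ _ eecK ltac:(lia).
by have := finset.in_setT i; rewrite -JK inE (negPf iJ) (negPf iK).
Qed.

Lemma rational_oppV (x : R) : 0 < x -> rational (- x^-1) -> rational x.
Proof.
move=> x0 [q _ qE]; exists (- q^-1) => //.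
by rewrite rmorphN fmorphV /= qE invrN invrK opprK.
Qed.

(** An opposite pair is itself an EEC. If other members exist, subtracting the pair leaves an EEC of
    positive multiplicity, which is a reduction. *)
Lemma irreducible_eec_pair (I : finType) (alpha : I -> R) (m : nat) :
  (forall i, 0 < alpha i) -> (exists i, ~ rational (alpha i)) ->
  irreducible_eec (fun i => beatty (alpha i) 0) m -> #|I| = 2%N.
Proof.
move=> a0 [i1 irr1] [eecI nred].
have [sumI [z0 [c Fc]]] := (is_eec_beattyP _ _ a0).1 eecI.
have [||i [j [l [irr ijl]]]] := @exists_opposite_pair R I (fun i => - (alpha i)^-1) c z0.
- by move=> z /Fc <-; apply: eq_bigl => i; rewrite inE.
- by exists i1 => /(rational_oppV (a0 _)).
have ij : i != j.
  apply/negP => /eqP ij; apply: irr; apply: (@rational_of_eq _ _ l 2) => //.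
  by rewrite -ijl -ij; ring.
have V0 k : 0 < (alpha k)^-1 by rewrite invr_gt0.
(* The slopes are negative, so [l < 0] and the multiplicity of the pair is [- l]. *)
have ln : (absz l)%:R = (alpha i)^-1 + (alpha j)^-1.
  have l0 : l%:~R < 0 :> R by rewrite -ijl; have := V0 i; have := V0 j; lra.
  by rewrite natr_absz intr_norm ltr0_norm // -ijl; ring.
have l0 : (0 < absz l)%N by rewrite -(ltr0n R) ln addr_gt0.
have eecJ : is_eec (fun i => beatty (alpha i) 0) [set i; j]%SET (absz l).
  apply: pair_is_eec => // irr'; apply: irr; case: irr' => q _ qE.
  by exists (- q^-1) => //; rewrite rmorphN fmorphV /= qE.
have [K0|] := eqVneq (~: [set i; j]%SET) finset.set0.
  by rewrite -cardsT -finset.setC0 -K0 finset.setCK cards2 ij.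
case/set0Pn => k kK; case: nred.
have [sumJ [z1 [c1 Fc1]]] := (is_eec_beattyP _ _ a0).1 eecJ.
have splitI (f : I -> R) : \sum_(x in [set: I]%SET) f x =
    \sum_(x in [set i; j]%SET) f x + \sum_(x in ~: [set i; j]%SET) f x.
  rewrite (bigID (mem [set i; j]%SET)) /=.
  by congr (_ + _); apply: eq_bigl => x; rewrite !inE.
have sumK : \sum_(x in ~: [set i; j]%SET) (alpha x)^-1 = m%:R - (absz l)%:R.
  by rewrite -sumI -sumJ splitI; ring.
have lm : (absz l < m)%N.
  rewrite -(ltr_nat R) -subr_gt0 -sumK (bigD1 k) //=.
  by rewrite ltr_wpDr // sumr_ge0 // => x _; exact: ltW.
split; first exact: leq_ltn_trans lm.
exists (absz l), (m - absz l)%N, [set i; j]%SET, (~: [set i; j]%SET).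
split; first by split; [|rewrite subn_gt0|rewrite subnKC // ltnW].
split=> //; [exact: finset.setUCr | by rewrite -setI_eq0 finset.setICr |].
apply/(is_eec_beattyP _ _ a0); split; first by rewrite sumK natrB // ltnW.
exists (maxn z0 z1), (c - c1) => z; rewrite geq_max => /andP[/Fc Fz /Fc1 F1z].
by rewrite -Fz splitI F1z; ring.
Qed.

End BeattyCovers.

Unset Implicit Arguments.

Theorem theorem1p9 (R : realType) (m k : nat) (alpha : 'I_k -> R)
    (m_gt0 : (0 < m)%N)
    (alpha_gt0 : forall i, 0 < alpha i)
    (alpha_not_all_rational : ~ (forall i, @rational R (alpha i))) :
  irreducible_eec (fun i : 'I_k => beatty (alpha i) 0) m <->
  (k = 2%N /\ \sum_(i < k) 1 / alpha i = m%:R).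
Proof.
have [i irr] : exists i, ~ rational (alpha i).
  by apply: contrapT => H; apply: alpha_not_all_rational => i;
     apply: contrapT => irr; apply: H; exists i.
have sumE : \sum_(i < k) 1 / alpha i = \sum_(i in [set: 'I_k]%SET) (alpha i)^-1.
  by apply: eq_big => [x|x _]; rewrite ?inE // div1r.
rewrite sumE; split=> [irrm|[k2 sumk]].
  split; last by have [/(is_eec_beattyP _ _ alpha_gt0)[]] := irrm.
  by rewrite -[LHS]card_ord; apply: irreducible_eec_pair irrm => //; exists i.
have card2 : #|[set: 'I_k]%SET| = 2%N by rewrite cardsT card_ord.
have /eqP/cards1P[j jE] : #|[set: 'I_k]%SET :\ i| = 1%N.
  by have := cardsD1 i [set: 'I_k]%SET; rewrite card2 finset.in_setT add1n => -[<-].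
have ij : i != j.
  by have := finset.set11 j; rewrite -jE !inE eq_sym => /andP[].
have IE : [set: 'I_k]%SET = [set i; j]%SET by rewrite -(finset.setD1K (finset.in_setT i)) jE.
apply: (@irrational_pair_irreducible _ _ _ i j) => //.
by rewrite -sumk IE big_setU1 ?inE //= big_set1.
Qed.
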